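(* There is an absolute constant $c>0$ such that for all integers $r\ge 2$ and $k\ge 1$, \[L_r(k)\ge 2^{c\sqrt{\log k}} .\]
   Context: $K_n$ denotes the complete graph on $n$ vertices. A $k$-edge-coloring of a graph is an arbitrary assignment of one of $k$ colors to each edge; a subgraph is monochromatic if all of its edges have the same color. $\chi(H)$ denotes the chromatic number of a graph $H$. The diameter $\operatorname{diam}(H)$ is the maximum over pairs $u,v\in V(H)$ of the length (number of edges) of a shortest path in $H$ between $u$ and $v$ (infinite if $H$ is disconnected). For integers $r\ge 2$, $k\ge 1$, $L_r(k)$ is the smallest integer $L$ such that every $k$-edge-coloring of $K_{r^k+1}$ contains a monochromatic subgraph $H$ (not necessarily induced or spanning) with $\chi(H)\ge r+1$ and $\operatorname{diam}(H)\le L$. *)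

(* Defs.v *)
From HB Require Import structures.
From mathcomp Require Import all_boot all_order all_algebra.
From mathcomp Require Import boolp constructive_ereal.

Set Implicit Arguments.
Unset Strict Implicit.
Unset Printing Implicit Defensive.
Import Order.TTheory GRing.Theory Num.Theory.

(* Simple graphs whose vertices are drawn from [V]; not all of [V] need be
   used, so that a subgraph of a graph on [V] is again a graph on [V]. *)
Record graph (V : finType) := Graph {
  verts : {set V};
  edges : {set {set V}};
  edgesP : forall e, e \in edges -> (#|e| == 2) && (e \subset verts)
}.

Section Graphs.
Variable V : finType.
Implicit Types G H : graph V.

Definition adj H : rel V := fun u v => [set u; v] \in edges H.

Definition subgraph H G := (verts H \subset verts G) && (edges H \subset edges G).

Definition edge G := {e : {set V} | e \in edges G}.
Definition vert G := {v : V | v \in verts G}.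

Definition colorable H (m : nat) : Prop :=
  exists g : vert H -> 'I_m, forall x y, adj H (val x) (val y) -> g x != g y.

Lemma colorable_card H : colorable H #|V|.
Proof.
exists (fun x => enum_rank (val x)) => x y; apply: contraTneq => /enum_rank_inj xy.
rewrite xy /adj setUid; apply/negP => /edgesP.
by rewrite cards1.
Qed.

Lemma colorable_ex H : exists m, `[< colorable H m >].
Proof. by exists #|V|; apply/asboolP/colorable_card. Qed.

Definition chi H : nat := ex_minn (colorable_ex H).

Definition path_of_length H (u v : V) (n : nat) : bool :=
  [exists p : n.-tuple V,
    [&& path (adj H) u p, last u p == v & uniq (u :: p)]].

(* The bound [n < #|V|] loses no path, as paths do not repeat vertices; the
   distance is [+oo] when there is no path. *)
Definition dist H (u v : V) : \bar int :=
  \big[mine/+oo%E]_(n < #|V| | path_of_length H u v n) (n%:Z)%:E.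

Definition diam H : \bar int :=
  \big[maxe/0%E]_(u in verts H) \big[maxe/0%E]_(v in verts H) dist H u v.

Definition monochromatic G (k : nat) (f : edge G -> 'I_k) H : Prop :=
  forall e1 e2 : edge G,
    val e1 \in edges H -> val e2 \in edges H -> f e1 = f e2.

Lemma completeP e : e \in [set e : {set V} | #|e| == 2] ->
  (#|e| == 2) && (e \subset [set: V]).
Proof. by rewrite inE subsetT andbT. Qed.

Definition complete : graph V := Graph completeP.

End Graphs.

Definition K (n : nat) : graph 'I_n := complete 'I_n.

Definition good (r k L : nat) : Prop :=
  forall f : edge (K (r ^ k + 1)) -> 'I_k,
    exists H : graph 'I_(r ^ k + 1),
      [/\ subgraph H (K (r ^ k + 1)), monochromatic f H,
          r + 1 <= chi H & (diam H <= (L%:Z)%:E)%E].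

Section Existence.

Lemma dist_le (V : finType) (H : graph V) u v :
  connect (adj H) u v -> (dist H u v <= (#|V|%:Z)%:E)%E.
Proof.
case/connectP => p0 p0P ->; case: (shortenP p0P) => p pP up _.
have sp : size p < #|V|.
  by rewrite -[_.+1]/(size (u :: p)) -(card_uniqP up) max_card.
rewrite /dist (bigD1 (Ordinal sp)) /=; last first.
  by apply/existsP; exists (in_tuple p); rewrite pP eqxx up.
by rewrite ge_min lee_fin lez_nat ltnW.
Qed.

Lemma diam_le (V : finType) (H : graph V) :
  {in verts H &, forall u v, connect (adj H) u v} ->
  (diam H <= (#|V|%:Z)%:E)%E.
Proof.
move=> cH; rewrite /diam.
elim/big_ind: _ => [|x y xP yP|u uH]; rewrite ?lee_fin ?lez_nat //.
  by rewrite ge_max xP yP.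
elim/big_ind: _ => [|x y xP yP|v vH]; rewrite ?lee_fin ?lez_nat //.
  by rewrite ge_max xP yP.
exact/dist_le/cH.
Qed.

Lemma colorableW (V : finType) (H : graph V) m n :
  m <= n -> colorable H m -> colorable H n.
Proof.
move=> mn [g gP]; exists (fun x => widen_ord mn (g x)) => x y /gP.
by apply: contra => /eqP [] /val_inj ->.
Qed.

Variables (r k : nat).
Let V : finType := 'I_(r ^ k + 1).
Variable f : edge (K (r ^ k + 1)) -> 'I_k.

Let E i : {set {set V}} := [set val e | e : edge (K (r ^ k + 1)) & f e == i].
Let C i x : {set V} := [set y | connect (fun u v => [set u; v] \in E i) x y].

Let compP i x e : e \in [set e in E i | e \subset C i x] ->
  (#|e| == 2) && (e \subset C i x).
Proof.
rewrite inE => /andP[/imsetP[[d dK] _ /= ->] ->]; rewrite andbT.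
by move: dK; rewrite inE.
Qed.

Let comp i x : graph V := Graph (@compP i x).

Let E_sym i : connect_sym (fun u v => [set u; v] \in E i).
Proof. by apply: sym_connect_sym => u v; rewrite setUC. Qed.

Let comp_mono i x : monochromatic f (comp i x).
Proof.
have key e : val e \in edges (comp i x) -> f e = i.
  by rewrite inE => /andP[/imsetP[d]]; rewrite inE => /eqP <- /val_inj ->.
by move=> e1 e2 /key -> /key ->.
Qed.

Let comp_sub i x : subgraph (comp i x) (K (r ^ k + 1)).
Proof.
rewrite /subgraph subsetT; apply/subsetP => e /= /compP /andP[e2 _].
by rewrite inE.
Qed.

Let comp_conn i x :
  {in verts (comp i x) &, forall u v, connect (adj (comp i x)) u v}.
Proof.
have key v : connect (fun u v => [set u; v] \in E i) x v ->
    connect (adj (comp i x)) x v.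
  case/connectP => p; elim/last_ind: p v => [|p z IH] v.
    by move=> _ ->; exact: connect0.
  rewrite rcons_path last_rcons => /andP[pp ez] ->.
  apply: connect_trans (IH _ pp erefl) (connect1 _).
  have xl : connect (fun u v => [set u; v] \in E i) x (last x p).
    by apply/connectP; exists p.
  rewrite /adj inE ez subUset !sub1set !inE xl.
  exact: connect_trans xl (connect1 ez).
have sy : connect_sym (adj (comp i x)).
  by apply: sym_connect_sym => u v; rewrite /adj setUC.
move=> u v; rewrite !inE => /key xu /key; apply: connect_trans.
by rewrite sy.
Qed.

Let exists_bad : exists i x, ~ colorable (comp i x) r.
Proof.
apply: contrapT => none.
have col i x : colorable (comp i x) r.
  by apply: contrapT => h; apply: none; exists i, x.
pose ro i x := fingraph.root (fun u v => [set u; v] \in E i) x.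
have inro i x : x \in verts (comp i (ro i x)).
  by rewrite inE E_sym connect_root.
pose g i x : 'I_r := sval (cid (col i (ro i x))) (exist _ x (inro i x)).
have /leq_card : injective (fun x : V => [ffun i => g i x] : {ffun 'I_k -> 'I_r}).
  move=> x y /ffunP gxy; apply/eqP/negP => /negP xy.
  have eK : [set x; y] \in edges (K (r ^ k + 1)) by rewrite inE cards2 xy.
  pose d : edge (K (r ^ k + 1)) := exist (fun e => e \in edges (K _)) _ eK.
  pose i := f d.
  have eE : [set x; y] \in E i.
    by apply/imsetP; exists d; rewrite ?inE.
  have rxy : ro i x = ro i y.
    by apply/eqP; rewrite root_connect //; exact: connect1.
  have := gxy i; rewrite !ffunE /g.
  move: (inro i x) (inro i y); rewrite -rxy => ix iy; apply/eqP.
  case: (cid _) => h /= hP; apply: hP => /=.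
  by rewrite /adj inE eE subUset !sub1set ix iy.
by rewrite card_ffun !card_ord addn1 ltnn.
Qed.

Lemma good_coloring : exists H : graph V,
  [/\ subgraph H (K (r ^ k + 1)), monochromatic f H, r + 1 <= chi H
    & (diam H <= ((r ^ k + 1)%:Z)%:E)%E].
Proof.
have [i [x nc]] := exists_bad; exists (comp i x); split => //.
- rewrite addn1 ltnNge; apply/negP => chir; apply: nc.
  move: chir; rewrite /chi; case: ex_minnP => m /asboolP mP _ mr.
  exact: colorableW mr mP.
- by have := diam_le (@comp_conn i x); rewrite card_ord.
Qed.

End Existence.

Lemma good_ex r k : exists L, `[< good r k L >].
Proof. by exists (r ^ k + 1); apply/asboolP => f; exact: good_coloring. Qed.

Definition L (r k : nat) : nat := ex_minn (good_ex r k).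

(* Main.v *)
Require Import Defs.
From mathcomp Require Import all_boot all_order all_algebra.
From mathcomp Require Import all_classical all_reals all_analysis.
From mathcomp Require Import perm zify lra.

(** Identify r^k of the vertices with words of length k over r letters, and let
    s be the remaining vertex. If two words always got the index of a position
    where they differ as their colour, the letters would properly r-colour every
    colour class off s; the edges at s spoil this. Give each position i a
    potential phi_i on words: an edge between words may only get colour i if
    phi_i changes by at most 1 along it, and s is joined in colour i only to
    words with phi_i = 0 and x_i <> 0, or with phi_i = d_i and x_i = 0. A
    monochromatic subgraph of diameter at most d_i / 2 then splits into a part
    near each end of phi_i, and recolouring one of them makes room for s, so it
    is r-colourable.

    Starting from k = 1 and d = 1, a new position turns one width d into the two
    widths d + 1 and 2 d + 1. Doubling a width 2^j therefore takes at most 2^j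
    increments, each of which leaves one position of double width behind, and
    at most 2^(n (n + 2)) positions suffice to bring all widths to 2^n. Hence
    log L grows like the square root of log k. *)

Import Order.TTheory GRing.Theory Num.Theory.

Set Implicit Arguments.
Unset Strict Implicit.
Unset Printing Implicit Defensive.

(** * Systems of potentials and operations on them *)

Section Systems.
Variable r : nat.

Definition separated (I : finType) (phi : I -> {ffun I -> 'I_r} -> nat) i
    (x y : {ffun I -> 'I_r}) : bool :=
  [&& x i != y i, phi i x <= (phi i y).+1 & phi i y <= (phi i x).+1].

Definition attached (I : finType) (d : I -> nat)
    (phi : I -> {ffun I -> 'I_r} -> nat) i (x : {ffun I -> 'I_r}) : bool :=
  (phi i x == 0) && (val (x i) != 0) || (phi i x == d i) && (val (x i) == 0).

(* The colours [i : I] serve the complete graph on the words [{ffun I -> 'I_r}]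
   together with one extra vertex [s]: [x] and [y] may receive the colour [i] if
   they are [separated] at [i], and [x] and [s] if [x] is [attached] at [i].
   Distances from [s] in colour [i] are governed by the potential [phi i], whose
   ends [0] and [d i] are the only values at neighbours of [s]. *)
Definition system (I : finType) (d : I -> nat) : Prop :=
  exists phi : I -> {ffun I -> 'I_r} -> nat,
    (forall x y, x != y -> exists i, separated phi i x y) /\
    (forall x, exists i, attached d phi i x).

Lemma system_unit : system (fun _ : unit => 1).
Proof.
exists (fun _ (x : {ffun unit -> 'I_r}) => nat_of_bool (val (x tt) == 0)).
split => [x y xy|x]; exists tt.
  rewrite /separated !(leq_trans (leq_b1 _)) // !andbT.
  by apply: contraNneq xy => xy; apply/eqP/ffunP => -[].
by rewrite /attached; case: (val _ == 0).
Qed.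

Definition split_width (I : finType) (d : I -> nat) i0 (o : option I) : nat :=
  if o is Some i then d i + (i == i0) else (d i0).*2.+1.

Lemma system_split (I : finType) (d : I -> nat) (i0 : I) :
  system d -> system (split_width d i0).
Proof.
move=> [phi [sep att]].
pose p (z : {ffun option I -> 'I_r}) : {ffun I -> 'I_r} :=
  [ffun i => z (Some i)].
pose psi o z :=
  if o is Some i then phi i (p z) + (i == i0) * (val (z None) != 0)
  else (phi i0 (p z)).*2 + (val (z None) == 0).
exists psi; split => [z z' zz'|z].
- have [pz|/sep[i]] := eqVneq (p z) (p z').
    exists None; rewrite /separated /psi pz; apply/andP; split; last first.
      by do 2 case: (_ == 0); lia.
    apply: contraNneq zz' => zN; apply/eqP/ffunP => -[i|//].
    by move/ffunP/(_ i): pz; rewrite !ffunE.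
  rewrite /separated !ffunE => /and3P[zi le1 le2].
  have [ii0|ii0] := eqVneq i i0; last first.
    by exists (Some i); rewrite zi /psi (negPf ii0) !mul0n !addn0 le1 le2.
  rewrite {}ii0 in zi le1 le2.
  case: (boolP (separated psi (Some i0) z z')) => [|h].
    by exists (Some i0).
  (* If [Some i0] fails, the new letter becomes or ceases to be nonzero in the direction in which
     [phi i0] moves by 1. It enters [psi None] with the opposite sign, so the doubled change 2
     shrinks to 1. *)
  exists None; move: h; rewrite /separated /psi zi eqxx !mul1n /=.
  have [->|_] /= := eqVneq (z None) (z' None).
    by rewrite -!addSn !leq_add2r le1 le2.
  by do 2 case: (_ == 0); lia.
- have [i] := att (p z); rewrite /attached !ffunE.
  have [->|ii0] := eqVneq i i0; last first.
    by exists (Some i); rewrite /psi /split_width (negPf ii0) mul0n !addn0.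
  (* At either end of [phi i0], the new letter decides which of [Some i0] and [None] sits at an end
     of its potential. *)
  case/orP=> /andP[/eqP e1 e2]; have [z0|z0] := eqVneq (val (z None)) 0.
  + by exists (Some i0); rewrite /psi e1 z0 e2 eqxx.
  + by exists None; rewrite /psi e1 z0 (negPf z0).
  + by exists None; rewrite /psi /split_width e1 z0 !eqxx addn1 eqxx.
  + by exists (Some i0); rewrite /psi /split_width e1 z0 e2 !eqxx orbT.
Qed.

Lemma system_truncate (I : finType) (d : I -> nat) D :
  (forall i, D <= d i) -> system d -> system (fun _ : I => D).
Proof.
move=> Dd [phi [sep att]]; exists (fun i x => minn D (phi i x)).
split => [x y /sep[i /and3P[xy le1 le2]]|x].
  by exists i; rewrite /separated xy /=; lia.
have [i xi] := att x; exists i; move: xi; rewrite /attached.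
case/orP => /andP[/eqP -> ->]; rewrite ?minn0 // andbT.
by rewrite (minn_idPl (Dd i)) eqxx orbT.
Qed.

(** All new potentials depend only on the letters at the image of [I]. Words that agree there are
    therefore separated at any position where they differ. *)
Lemma system_ord (I : finType) D k :
  #|I| <= k -> system (fun _ : I => D) -> system (fun _ : 'I_k => D).
Proof.
move=> Ik [phi [sep att]].
pose e i := widen_ord Ik (enum_rank i).
have e_inj : injective e by move=> i j /(congr1 val)/= /val_inj/enum_rank_inj.
pose p (z : {ffun 'I_k -> 'I_r}) : {ffun I -> 'I_r} := [ffun i => z (e i)].
pose psi j z := if [pick i | e i == j] is Some i then phi i (p z) else 0.
have psiE i z : psi (e i) z = phi i (p z).
  by rewrite /psi; case: pickP => [j /eqP/e_inj ->|/(_ i)] //; rewrite eqxx.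
exists psi; split => [z z' zz'|z]; last first.
  have [i zi] := att (p z); exists (e i).
  by move: zi; rewrite /attached psiE !ffunE.
have [pz|/sep[i zi]] := eqVneq (p z) (p z'); last first.
  by exists (e i); move: zi; rewrite /separated !psiE !ffunE.
have [j zj] : exists j, z j != z' j.
  apply/existsP; apply: contraNT zz'; rewrite negb_exists => /forallP h.
  by apply/eqP/ffunP => j; apply/eqP; rewrite -[_ == _]negbK.
exists j; rewrite /separated zj /psi pz leqnSn /=.
by case: [pick i | e i == j].
Qed.

End Systems.

(** * Counting the positions needed for width [2 ^ n] *)

Section Growth.
Variable n : nat.
Let D := 2 ^ n.

(* An upper bound for the number of coordinates of width at least [2 ^ n] that
   arise when one coordinate of width [d] is split repeatedly. *)
Definition weight d := (D - d).+1 * (2 ^ n.+1) ^ (n - trunc_log 2 d).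

Lemma weight_gt0 d : 0 < weight d.
Proof. by rewrite muln_gt0 expn_gt0 expn_gt0. Qed.

Lemma weight1 : weight 1 = 2 ^ (n * n.+2).
Proof.
rewrite /weight /D trunc_log1 subn0 -expnM subn1 prednK ?expn_gt0 // -expnD.
by congr (2 ^ _); lia.
Qed.

(** Incrementing [d] lowers the first factor by 1, which frees one copy of the power. Doubling
    divides the power by [2 ^ n.+1], which bounds the first factor, so its weight fits into that
    copy. *)
Lemma weight_split d : 0 < d < D -> weight d.+1 + weight d.*2.+1 <= weight d.
Proof.
case/andP => d0 dD; rewrite /weight.
have lo := trunc_logP (isT : 1 < 2) d0.
have hi := trunc_log_ltn d (isT : 1 < 2).
have -> : trunc_log 2 d.*2.+1 = (trunc_log 2 d).+1.
  apply: trunc_log_eq => //; move: hi; rewrite !expnS; lia.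
have jn : trunc_log 2 d < n by rewrite -(@ltn_exp2l 2) // (leq_ltn_trans lo).
have le1 : (2 ^ n.+1) ^ (n - trunc_log 2 d.+1)
    <= (2 ^ n.+1) ^ (n - trunc_log 2 d).
  rewrite leq_exp2l; last by rewrite -[1](expn0 2) ltn_exp2l.
  by apply: leq_sub2l; apply: leq_trunc_log.
rewrite [leqRHS]mulSn addnC.
apply: leq_add; last by rewrite subnSK // leq_mul2l le1 orbT.
rewrite -[in leqRHS](subnSK jn) [in leqRHS]expnS leq_mul2r; apply/orP; right.
rewrite [leqRHS]expnS.
by rewrite -/D; lia.
Qed.

End Growth.

Lemma sum_option (I : finType) (F : option I -> nat) :
  \sum_o F o = F None + \sum_i F (Some i).
Proof.
rewrite (bigD1 None) //=; congr (_ + _).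
rewrite (reindex_omap Some id) => [|[]] //.
by apply: eq_bigl => i; rewrite eqxx.
Qed.

Lemma system_grow r n (I : finType) (d : I -> nat) :
    (forall i, 0 < d i) -> system r d ->
  exists2 J : finType, #|J| <= \sum_i weight n (d i)
    & system r (fun _ : J => 2 ^ n).
Proof.
(* Induction on the slack between total weight and number of positions: a split adds a position
   without raising the weight, and every weight is at least 1. *)
pose m := \sum_i weight n (d i) - #|I|.
have: \sum_i weight n (d i) <= #|I| + m by rewrite -leq_subLR.
have card_le (J : finType) (e : J -> nat) : #|J| <= \sum_i weight n (e i).
  by rewrite -sum1_card leq_sum // => i _; apply: weight_gt0.
move: m => m; elim: m I d => [|m IHm] I d wd d0 sysd;
    (have [/forallP dD|] := boolP [forall i, 2 ^ n <= d i];
      first by exists I => //; apply: system_truncate sysd);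
  rewrite negb_forall => /existsP[i0]; rewrite -ltnNge => di0;
  have w_le : \sum_o weight n (split_width d i0 o) <= \sum_i weight n (d i).
  1,3: rewrite sum_option /= (bigD1 i0) //= eqxx addn1 [leqRHS](bigD1 i0) //=;
    rewrite addnCA addnA leq_add ?weight_split ?d0 //;
    by apply: leq_sum => i /negPf ->; rewrite addn0.
- have := card_le _ (split_width d i0); rewrite card_option => lt_w.
  by have := leq_trans (leq_trans lt_w w_le) wd; rewrite addn0 ltnn.
- case: (IHm _ (split_width d i0)).
  + by rewrite card_option addSnnS (leq_trans w_le).
  + by case=> [i|] //=; rewrite addn_gt0 d0.
  + exact: system_split.
  + by move=> J Jw sysJ; exists J => //; apply: leq_trans w_le.
Qed.

(** * Colouring graphs of small diameter by a potential *)

Lemma diam_path (V : finType) (H : graph V) (l : nat) u v :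
    (diam H <= (l%:Z)%:E)%E -> u \in verts H -> v \in verts H ->
  exists2 n, n <= l & path_of_length H u v n.
Proof.
move=> Hl uH vH.
have {Hl} : (dist H u v <= (l%:Z)%:E)%E.
  apply: le_trans Hl; rewrite /diam.
  apply: le_trans (le_bigmax_cond _ _ uH).
  exact: (le_bigmax_cond _ _ vH).
rewrite /dist; elim/big_ind: _ => [|x y xP yP|n uvn].
- by rewrite leye_eq.
- by rewrite ge_min => /orP[].
- by rewrite lee_fin lez_nat => nl; exists n.
Qed.

Lemma adjC (V : finType) (H : graph V) : symmetric (adj H).
Proof. by move=> u v; rewrite /adj finset.setUC. Qed.

Lemma adj_neq (V : finType) (H : graph V) u v : adj H u v -> u != v.
Proof. by rewrite /adj => /edgesP/andP[]; rewrite cards2; case: (u != v). Qed.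

Lemma path_potential (V : finType) (H : graph V) (phi : V -> nat) s u p :
    (forall v w, v != s -> w != s -> adj H v w -> phi v <= (phi w).+1) ->
    s \notin u :: p -> path (adj H) u p ->
  phi (last u p) <= phi u + size p /\ phi u <= phi (last u p) + size p.
Proof.
move=> lip; elim: p u => [|w p IHp] u /=; first by rewrite addn0.
rewrite !in_cons !negb_or => /and3P[su sw sp] /andP[uw wp].
have {IHp}[] := IHp w; rewrite ?in_cons ?negb_or ?sw ?sp //.
have := lip u w; have := lip w u; rewrite ![_ == s]eq_sym adjC.
move=> /(_ sw su uw) le1 /(_ su sw uw) le2 le3 le4; rewrite -addSnnS addnS.
by rewrite (leq_trans le3) ?leq_add2r // (leq_trans le2) ?ltnS.
Qed.

(* Within distance [l] of [s] the potential lies within [l - 1] of one of its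
   ends, so the vertices fall into a low and a high part with no edge between
   them. Transposing the colours [0] and [1] on the high part frees the colour
   [0] for [s]. *)
Lemma potential_colorable (V : finType) (H : graph V) r D l (s : V)
    (x : V -> 'I_r.+2) (phi : V -> nat) :
    (forall u v, u != s -> v != s -> adj H u v ->
       x u != x v /\ phi u <= (phi v).+1) ->
    (forall v, adj H s v ->
       (phi v == 0) && (x v != ord0) || (phi v == D) && (x v == ord0)) ->
    l.*2 <= D -> (diam H <= (l%:Z)%:E)%E ->
  colorable H r.+2.
Proof.
move=> Hx Hs lD Hl.
have lip u v : u != s -> v != s -> adj H u v -> phi u <= (phi v).+1.
  by move=> us vs /(Hx _ _ us vs)[].
have [sH|sH] := boolP (s \in verts H); last first.
  have ns (u : vert H) : val u != s.
    by apply: contraNneq sH => <-; apply: valP.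
  by exists (fun u => x (val u)) => u v /(Hx _ _ (ns u) (ns v))[].
(* A path from [s] first reaches an end of the potential, then never returns to [s] and has at most
   [l - 1] edges left. *)
have ends v : v \in verts H -> v != s -> (phi v < l) || (D < phi v + l).
  move=> vH vs; have [n nl] := diam_path Hl sH vH.
  case/existsP => p /and3P[]; case: p => -[|w p] /= sz.
    by rewrite eq_sym (negPf vs).
  case/andP=> sw wp /eqP <- /and3P[sp _ _].
  have [] := path_potential lip sp wp.
  have := Hs _ sw; move/eqP: sz => /=; lia.
pose t : {perm 'I_r.+2} := tperm ord0 (inord 1).
pose g v := if v == s then ord0 else if phi v < l then x v else t (x v).
have gs v : v \in verts H -> adj H s v -> g v != ord0.
  move=> vH sv; have vs : v != s by rewrite eq_sym (adj_neq sv).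
  have := ends _ vH vs; rewrite /g (negPf vs).
  case/orP: (Hs _ sv) => /andP[/eqP-> x0] pl.
    by have -> : 0 < l by lia.
  have -> : D < l = false by lia.
  by rewrite (eqP x0) tpermL -val_eqE /= inordK.
exists (fun u => g (val u)) => u v uv.
have [us|us] := eqVneq (val u) s.
  by rewrite {1}/g us eqxx eq_sym gs ?(valP v) // -us.
have [vs|vs] := eqVneq (val v) s.
  by rewrite {2}/g vs eqxx gs ?(valP u) // adjC -vs.
have [xuv luv] := Hx _ _ us vs uv.
have lvu := lip _ _ vs us (etrans (adjC _ _ _) uv).
have := ends _ (valP u) us; have := ends _ (valP v) vs.
rewrite /g (negPf us) (negPf vs).
(* Low potentials are at most [l - 1] and high ones at least [l + 1], as [l.*2 <= D]; so no edge
   joins the two parts. *)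
case: (ltnP (phi (val u)) l) => lu; case: (ltnP (phi (val v)) l) => lv eu ev.
- by [].
- by lia.
- by lia.
- by rewrite (inj_eq perm_inj).
Qed.

(** * The edge colouring given by a system *)

Section Coloring.
Variables (r k D : nat) (phi : 'I_k -> {ffun 'I_k -> 'I_r} -> nat).
Let T := option {ffun 'I_k -> 'I_r}.

Definition linked i (x y : T) : bool :=
  match x, y with
  | Some x, Some y => separated phi i x y
  | None, Some x | Some x, None => attached (fun _ => D) phi i x
  | None, None => false
  end.

Lemma linkedC i : symmetric (linked i).
Proof.
by case=> [x|] [y|] //=; rewrite /separated eq_sym [X in _ && X]andbC.
Qed.

End Coloring.

Lemma system_not_good r k D l : 1 < r -> system r (fun _ : 'I_k => D) ->
  l.*2 <= D -> ~ good r k l.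
Proof.
case: r => [|[|r]] // _ [phi [sep att]] lD.
pose T := option {ffun 'I_k -> 'I_r.+2}.
have cardT : r.+2 ^ k + 1 = #|{: T}|.
  by rewrite card_option card_ffun !card_ord addn1.
pose pt (v : 'I_(r.+2 ^ k + 1)) : T := enum_val (cast_ord cardT v).
have pt_inj : injective pt by move=> u v /enum_val_inj/cast_ord_inj.
pose s : 'I_(r.+2 ^ k + 1) := cast_ord (esym cardT) (enum_rank None).
have pts : pt s = None by rewrite /pt cast_ordKV enum_rankK.
have ptN v : v != s -> exists x, pt v = Some x.
  case E : (pt v) => [x|]; first by exists x.
  by rewrite -(inj_eq pt_inj) E pts.
have link (x y : T) : x != y -> exists i, linked D phi i x y.
  case: x y => [x|] [y|] //= xy; try exact: att.
  exact/sep.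
pose joins i (e : {set _}) :=
  [forall u in e, forall v in e, (u != v) ==> linked D phi i (pt u) (pt v)].
have link_edge (e : edge (K (r.+2 ^ k + 1))) : exists i, joins i (val e).
  case: e => e /= eK; have : #|e| == 2 by move: eK; rewrite inE.
  case/cards2P => u [v [uv ->]].
  have [|i uvi] := link (pt u) (pt v); first by rewrite inj_eq.
  exists i; apply/forall_inP => u' u'e; apply/forall_inP => v'.
  move: u'e; rewrite !inE => /orP[] /eqP -> /orP[] /eqP ->;
    rewrite ?eqxx ?uvi ?implybT //.
  by rewrite linkedC uvi implybT.
case/(_ (fun e => xchoose (link_edge e))) => H.
case=> /andP[_ /fintype.subsetP HK] mono chiH diamH.
suff : colorable H r.+2.
  move: chiH; rewrite /chi; case: ex_minnP => m _ min_m rm /asboolP /min_m.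
  by move/(leq_trans rm); rewrite addn1 ltnn.
(* The colour of [H] is read off from one of its edges, so the edgeless case is settled first. *)
have [H0|[e0 e0H]] := set_0Vmem (edges H).
  by exists (fun=> ord0) => u v; rewrite /adj H0 inE.
pose lift e (eH : e \in edges H) : edge (K (r.+2 ^ k + 1)) :=
  exist (fun e => e \in edges (K _)) e (HK _ eH).
pose i := xchoose (link_edge (lift _ e0H)).
have adj_linked u v : adj H u v -> linked D phi i (pt u) (pt v).
  move=> uvH; have := xchooseP (link_edge (lift _ uvH)).
  rewrite (mono _ (lift _ e0H)) //= => /forall_inP/(_ u).
  rewrite !inE eqxx => /(_ isT) /forall_inP/(_ v).
  by rewrite !inE eqxx orbT (adj_neq uvH) => /(_ isT).
pose x v : 'I_r.+2 := if pt v is Some z then z i else ord0.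
pose rho v := if pt v is Some z then phi i z else 0.
apply: (@potential_colorable _ H r D l s x rho) => // [u v|v].
- move=> /ptN[y yP] /ptN[z zP] /adj_linked; rewrite /x /rho yP zP /=.
  by case/and3P.
- move=> sv; have /ptN[z zP] : v != s by rewrite eq_sym (adj_neq sv).
  by move/adj_linked: sv; rewrite /x /rho pts zP.
Qed.

(** * Lower bounds on [L] *)

Lemma system_width_lt_L r k D : (1 < r)%N -> system r (fun _ : 'I_k => D) ->
  (D < (L r k).*2)%N.
Proof.
move=> r1 sysD; rewrite ltnNge; apply/negP => lD.
apply: (system_not_good r1 sysD lD).
by rewrite /L; case: ex_minnP => l /asboolP.
Qed.

Lemma L_gt0 r k : (1 < r)%N -> (0 < k)%N -> (0 < L r k)%N.
Proof.
move=> r1 k0; rewrite -double_gt0; apply: (@leq_ltn_trans 1) => //.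
apply: system_width_lt_L => //; apply: system_ord (system_unit r).
by rewrite card_unit.
Qed.

(** One split of the unit system gives widths 2 and 3 on two positions. *)
Lemma L_gt1 r k : (1 < r)%N -> (1 < k)%N -> (1 < L r k)%N.
Proof.
move=> r1 k1; rewrite -ltn_double; apply: system_width_lt_L => //.
apply: (@system_ord _ (option unit)); first by rewrite card_option card_unit.
by apply: system_truncate (system_split tt (system_unit r)) => -[[]|].
Qed.

Lemma exp_lt_L r k n : (1 < r)%N -> (2 ^ (n * n.+2) <= k)%N ->
  (2 ^ n < (L r k).*2)%N.
Proof.
move=> r1 nk; apply: system_width_lt_L => //.
have [//|J] := @system_grow r n _ (fun _ : unit => 1%N) _ (system_unit r).
rewrite sum_nat_const card_unit mul1n weight1 => Jk.
exact/system_ord/(leq_trans Jk).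
Qed.

Lemma exp_le_L r k : (1 < r)%N -> (1 < k)%N ->
  exists2 m, (k < 2 ^ ((4 * m) ^ 2))%N & (2 ^ m <= L r k)%N.
Proof.
move=> r1 k1; pose P n := (2 ^ (n * n.+2) <= k)%N.
have P0 : exists n, P n by exists 0%N; rewrite /P ltnW.
have Pk n : P n -> (n <= k)%N.
  move=> Pn; apply: leq_trans Pn.
  apply: leq_trans (ltnW (ltn_expl n (isT : 1 < 2)%N)) _.
  by rewrite leq_exp2l // mulnS leq_addr.
case: (ex_maxnP P0 Pk) => n Pn maxn.
have kn : (k < 2 ^ (n.+1 * n.+3))%N.
  by rewrite ltnNge; apply/negP => /maxn; rewrite ltnn.
have k_lt m : (n.+2 <= 4 * m)%N -> (k < 2 ^ ((4 * m) ^ 2))%N.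
  move=> nm; apply: leq_trans kn _; rewrite leq_exp2l // expnS expn1; nia.
(* Halving [2 ^ n] costs 1 in the exponent, so [m] is [n - 1]; the factor 4 gives [n + 2 <= 4 * m]
   for [n > 2], and [m = 1] serves smaller [n]. *)
have [n2|n2] := leqP n 2.
  by exists 1%N; [apply: k_lt; lia | apply: L_gt1].
exists n.-1; first by apply: k_lt; lia.
have := exp_lt_L r1 Pn; case: n n2 {P0 Pk Pn maxn kn k_lt} => // n _.
by rewrite expnS mul2n ltn_double => /ltnW.
Qed.

Local Open Scope ring_scope.

Theorem theorem1p5 (R : realType) :
  exists2 c : R, 0 < c &
    forall r k : nat, (2 <= r)%N -> (1 <= k)%N ->
      2 `^ (c * Num.sqrt (ln k%:R)) <= (L r k)%:R.
Proof.
(* The constant inverts the 4 in [k < 2 ^ ((4 * m) ^ 2)]: since [ln 2 <= 1], the root of [ln k] is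
   at most [4 * m]. *)
exists 4^-1 => [|r k r1]; first by rewrite invr_gt0 ltr0n.
rewrite leq_eqVlt => /predU1P[<-|k1].
  by rewrite ln1 sqrtr0 mulr0 powRr0 ler1n L_gt0.
have [m km mL] := exp_le_L r1 k1.
have ln2 : ln 2 <= 1 :> R.
  by have := @le_ln1Dx R 1; rewrite -[1 + 1]/(2%:R); apply; lra.
have lnk : ln k%:R <= (4 * m%:R) ^+ 2 :> R.
  apply: (@le_trans _ _ (ln (2 ^+ ((4 * m) ^ 2)))).
    rewrite ler_ln ?posrE ?exprn_gt0 ?ltr0n ?(ltnW k1) //.
    by rewrite -natrX ler_nat ltnW.
  by rewrite lnXn // -natrM -natrX -[ln 2 *+ _]mulr_natr ler_piMl.
apply: (@le_trans _ _ (2 `^ m%:R)).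
  apply: ler_powR; rewrite ?ler1n // ler_pdivrMl //.
  rewrite -ler_sqr ?nnegrE ?sqrtr_ge0 ?mulr_ge0 ?ler0n //.
  by rewrite sqr_sqrtr // ln_ge0 // ler1n ltnW.
by rewrite powR_mulrn // -natrX ler_nat.
Qed.
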